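(* Let $\mathcal{D}$ be a $J$-Engel structure on an almost complex $4$-manifold $(M,J)$, let $\mathcal{E}=[\mathcal{D},\mathcal{D}]$, and let $\mathcal{W}$ be the characteristic foliation of $\mathcal{D}$. Let $\alpha$ be a defining form for $\mathcal{E}$ (a $1$-form with $\mathcal{E}=\ker\alpha$), let $\beta=\alpha\circ J$, let $R$ be the vector field determined by $$i_R(\beta\wedge d\beta)=0,\qquad \beta(R)=0,\qquad \alpha(R)=1,$$ and let $\mathcal{Z}=\langle R\rangle$ be the line field spanned by $R$. Then the splitting of the tangent bundle $$TM=\mathcal{W}\oplus J\mathcal{W}\oplus J\mathcal{Z}\oplus\mathcal{Z}$$ does not depend on the choice of $\alpha$.
   Context: All manifolds are closed and smooth, and all distributions are smooth. An Engel structure on a $4$-manifold $M$ is a smooth $2$-plane field $\mathcal{D}\subset TM$ such that $\mathcal{E}:=[\mathcal{D},\mathcal{D}]$ has constant rank $3$ and $[\mathcal{D},\mathcal{E}]=TM$. Then $\mathcal{E}$ is an even contact structure (locally $\mathcal{E}=\ker\alpha$ with $\alpha\wedge d\alpha$ nowhere zero), and there is a unique line field $\mathcal{W}\subset\mathcal{E}$ with $[\mathcal{W},\mathcal{E}]\subset\mathcal{E}$, called the characteristic foliation; it satisfies $\mathcal{W}\subset\mathcal{D}$. If $J$ is an almost complex structure on $M$, a $J$-Engel structure is an Engel structure $\mathcal{D}$ with $J\mathcal{D}=\mathcal{D}$. Two $1$-forms $\alpha,\beta$ are Engel defining forms for $\mathcal{D}$ if $\mathcal{D}=\ker\alpha\cap\ker\beta$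 and $\mathcal{E}=\ker\alpha$; for $\mathcal{D}$ $J$-Engel and $\mathcal{E}=\ker\alpha$, the pair $\alpha$, $\beta=\alpha\circ J$ is a pair of Engel defining forms, and the conditions in the claim determine $R$ uniquely. *)

(* Defs.v *)
From HB Require Import structures.
From mathcomp Require Import all_boot all_order all_algebra.
From mathcomp Require Import all_classical all_reals all_analysis.
Set Implicit Arguments.
Unset Strict Implicit.
Unset Printing Implicit Defensive.
Import Order.TTheory GRing.Theory Num.Theory.
Import numFieldNormedType.Exports.
Local Open Scope classical_set_scope.
Local Open Scope ring_scope.

Section LinearAlgebra.
Variables (R : realType) (V : lmodType R).
Implicit Types S T : set V.

Definition lin_span S : set V :=
  [set v | exists (m : nat) (a : 'I_m -> R) (s : 'I_m -> V),
     (forall i, S (s i)) /\ v = \sum_i a i *: s i].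

Definition lin_indep (k : nat) (b : 'I_k -> V) : Prop :=
  forall a : 'I_k -> R, \sum_i a i *: b i = 0 -> forall i, a i = 0.

Definition is_basis (k : nat) (b : 'I_k -> V) S : Prop :=
  lin_indep b /\ S = lin_span (range b).

Definition has_dim (k : nat) S : Prop := exists b : 'I_k -> V, is_basis b S.

(* T is the internal direct sum of the V_ i. *)
Definition is_direct_sum (k : nat) (V_ : 'I_k -> set V) T : Prop :=
  (forall w : 'I_k -> V, (forall i, V_ i (w i)) -> T (\sum_i w i)) /\
  (forall v, T v ->
     exists! w : 'I_k -> V, (forall i, V_ i (w i)) /\ v = \sum_i w i).

End LinearAlgebra.

Section Manifolds.
Variables (R : realType) (n : nat).

(* On an open set U: all partial derivatives of order at most k exist and are
   continuous. *)
Fixpoint C_ (k : nat) (U : set 'rV[R]_n) (f : 'rV[R]_n -> R) : Prop :=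
  (forall x, U x -> {for x, continuous f}) /\
  if k is k'.+1 then
    forall i : 'I_n,
      (forall x, U x -> derivable f x (delta_mx 0 i)) /\
      C_ k' U (fun x => 'D_(delta_mx 0 i) f x)
  else True.

Definition Cinfty (U : set 'rV[R]_n) (f : 'rV[R]_n -> R) : Prop :=
  forall k, C_ k U f.

(* A homeomorphism from an open set chart_dom onto an open subset of R^n;
   chart_fun and chart_inv take arbitrary values elsewhere. *)
Record chart (M : topologicalType) := Chart {
  chart_dom : set M;
  chart_fun : M -> 'rV[R]_n;
  chart_inv : 'rV[R]_n -> M;
  chart_dom_open : open chart_dom;
  chart_img_open : open (chart_fun @` chart_dom);
  chart_funK : forall p, chart_dom p -> chart_inv (chart_fun p) = p;
  chart_fun_cts : {within chart_dom, continuous chart_fun};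
  chart_inv_cts : {within chart_fun @` chart_dom, continuous chart_inv}
}.

Definition smooth_transition (M : topologicalType) (c d : chart M) : Prop :=
  forall i : 'I_n,
    Cinfty (chart_fun c @` (chart_dom c `&` chart_dom d))
           (fun x => chart_fun d (chart_inv c x) 0 i).

Record smoothManifold := SmoothManifold {
  carrier :> topologicalType;
  atlas : set (chart carrier);
  carrier_hausdorff : hausdorff_space carrier;
  carrier_countable : @second_countable carrier;
  atlas_cover : forall p : carrier, exists2 c, atlas c & chart_dom c p;
  atlas_compat : forall c d, atlas c -> atlas d -> smooth_transition c d
}.

(* Closed means compact; the model R^n leaves no boundary. *)
Definition closed_manifold (M : smoothManifold) : Prop := compact [set: M].

End Manifolds.

Section TangentBundle.
Variables (R : realType) (n : nat) (M : smoothManifold R n).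
Implicit Types (p q : M) (U : set M) (f g : M -> R).

(* The ambient vector space of the tangent spaces: a tangent vector is a
   derivation of germs of smooth functions, encoded as a functional on all
   functions M -> R that vanishes on those not smooth near the base point. With
   this convention two tangent vectors at p are equal iff they agree on germs. *)
Local Notation TV := ((M -> R) -> R).
Local Notation vfield := (M -> TV).

Definition smooth_on U f : Prop :=
  forall c, atlas c ->
    Cinfty (chart_fun c @` (chart_dom c `&` U)) (f \o chart_inv c).

Definition smooth_at f p : Prop := exists2 U, open_nbhs p U & smooth_on U f.

(* T_p M. That v only depends on germs at p follows from the Leibniz rule,
   since a function smooth only near p is already in its domain. *)
Definition tangent p : set TV := [set v : TV |
  [/\ forall f, ~ smooth_at f p -> v f = 0,
      forall (a : R) f g, smooth_at f p -> smooth_at g p ->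
        v (fun q => a * f q + g q) = a * v f + v g
    & forall f g, smooth_at f p -> smooth_at g p ->
        v (fun q => f q * g q) = f p * v g + g p * v f]].

Definition vf_app (X : vfield) f : M -> R := fun q => X q f.

Definition smooth_vfield U (X : vfield) : Prop :=
  forall p, U p ->
    tangent p (X p) /\ forall f, smooth_at f p -> smooth_at (vf_app X f) p.

(* The test on f keeps the value in tangent p for fields smooth near p. *)
Definition lie_bracket (X Y : vfield) : vfield := fun p f =>
  if `[< smooth_at f p >] then X p (vf_app Y f) - Y p (vf_app X f) else 0.

(** Distributions *)

Definition is_section (D : M -> set TV) U (X : vfield) : Prop :=
  smooth_vfield U X /\ forall p, U p -> D p (X p).

Definition plane_field (k : nat) (D : M -> set TV) : Prop :=
  forall p, exists U (X : 'I_k -> vfield),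
    [/\ open_nbhs p U, forall i, is_section D U (X i)
      & forall q, U q -> is_basis (fun i => X i q) (D q)].

Definition bracket_dist (D E : M -> set TV) : M -> set TV := fun p =>
  lin_span [set v : TV | exists U (X Y : vfield),
    [/\ open_nbhs p U, is_section D U X, is_section E U Y
      & v = lie_bracket X Y p]].

Definition engel (D : M -> set TV) : Prop :=
  [/\ plane_field 2 D,
      forall p, has_dim 3 (bracket_dist D D p)
    & forall p, bracket_dist D (bracket_dist D D) p = tangent p].

Definition characteristic_foliation (D W : M -> set TV) : Prop :=
  let E := bracket_dist D D in
  [/\ plane_field 1 W, forall p, W p `<=` E p
    & forall p, bracket_dist W E p `<=` E p].

(** Almost complex structures *)

(* Values of J p and of forms outside tangent p are irrelevant. *)
Definition almost_complex (J : M -> TV -> TV) : Prop :=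
  [/\ forall p v, tangent p v -> tangent p (J p v),
      forall p (a : R) u v, tangent p u -> tangent p v ->
        J p (a *: u + v) = a *: J p u + J p v,
      forall p v, tangent p v -> J p (J p v) = - v
    & forall U X, open U -> smooth_vfield U X ->
        smooth_vfield U (fun p => J p (X p))].

Definition J_image (J : M -> TV -> TV) (D : M -> set TV) : M -> set TV :=
  fun p => J p @` D p.

Definition J_engel (J : M -> TV -> TV) (D : M -> set TV) : Prop :=
  engel D /\ forall p, J_image J D p = D p.

(** Differential forms *)

Definition one_form (alpha : M -> TV -> R) : Prop :=
  (forall p (a : R) u v, tangent p u -> tangent p v ->
     alpha p (a *: u + v) = a * alpha p u + alpha p v) /\
  (forall U X, open U -> smooth_vfield U X ->
     forall p, U p -> smooth_at (fun q => alpha q (X q)) p).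

Definition defining_form (E : M -> set TV) (alpha : M -> TV -> R) : Prop :=
  one_form alpha /\
  forall p, E p = [set v | tangent p v /\ alpha p v = 0].

Definition form_comp (alpha : M -> TV -> R) (J : M -> TV -> TV) :
  M -> TV -> R := fun p v => alpha p (J p v).

(* Forms of degree 2 and 3 are given by their values on (locally defined) smooth
   vector fields. *)
Definition eval_form (alpha : M -> TV -> R) (X : vfield) : M -> R :=
  fun p => alpha p (X p).

Definition ext_deriv (alpha : M -> TV -> R) (X Y : vfield) : M -> R := fun p =>
  X p (eval_form alpha Y) - Y p (eval_form alpha X)
  - eval_form alpha (lie_bracket X Y) p.

Definition wedge12 (alpha : M -> TV -> R) (omega : vfield -> vfield -> M -> R)
    (X Y Z : vfield) : M -> R := fun p =>
  eval_form alpha X p * omega Y Z p - eval_form alpha Y p * omega X Z p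
  + eval_form alpha Z p * omega X Y p.

Definition interior_prod (X : vfield)
    (eta : vfield -> vfield -> vfield -> M -> R) : vfield -> vfield -> M -> R :=
  fun Y Z => eta X Y Z.

Definition form2_zero (omega : vfield -> vfield -> M -> R) : Prop :=
  forall U X Y, open U -> smooth_vfield U X -> smooth_vfield U Y ->
  forall p, U p -> omega X Y p = 0.

Definition associated_vfield (J : M -> TV -> TV) (alpha : M -> TV -> R)
    (X : vfield) : Prop :=
  let beta := form_comp alpha J in
  [/\ smooth_vfield setT X,
      form2_zero (interior_prod X (wedge12 beta (ext_deriv beta))),
      forall p, beta p (X p) = 0
    & forall p, alpha p (X p) = 1].

Definition line_of (X : vfield) : M -> set TV := fun p => lin_span [set X p].

(* The summands W, JW, JZ, Z, in this order. *)
Definition splitting (J : M -> TV -> TV) (W Z : M -> set TV) (p : M) :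
    'I_4 -> set TV :=
  fun i => nth set0 [:: W p; J_image J W p; J_image J Z p; Z p] i.

End TangentBundle.

(* Main.v *)
(* Write beta = alpha o J. Since JR lies in E and beta(JR) = -1, a dimension count
   gives D = ker alpha /\ ker beta. If W were not contained in D at p, then near p
   every section of E would be the sum of a section of W and a section of D, so
   [D, E] would be contained in E; hence W is contained in D, D = W + JW, and
   alpha, beta split off Z and JZ.
   For Y in D, evaluating i_R(beta /\ d beta) on (Y, JR) gives beta([R, Y]) = 0.
   If R, R' are associated with alpha, alpha', the forms beta, beta' are
   proportional, so d = R' - alpha(R') R is a section of D with
   beta([d, Y]) = 0 for all Y in D. As beta([D, D]) <> 0 and D has rank 2, d = 0,
   and R, R' span the same line.
   Coordinates are never needed: smooth coefficients with respect to a frame of D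
   are obtained by Cramer's rule from the values of vector fields on functions. *)
Require Import Defs.
From HB Require Import structures.
From mathcomp Require Import all_boot all_order all_algebra.
From mathcomp Require Import all_classical all_reals all_analysis.
From mathcomp Require Import ring.
Import Order.TTheory GRing.Theory Num.Theory.
Import numFieldNormedType.Exports.
Local Open Scope classical_set_scope.
Local Open Scope ring_scope.
Set Implicit Arguments.
Unset Strict Implicit.
Unset Printing Implicit Defensive.

(** * Subspaces, linear spans, bases and direct sums *)

Section LinearSpan.
Variables (R : realType) (V : lmodType R).
Implicit Types (S T : set V) (k : nat).

Definition subspace T : Prop :=
  T 0 /\ forall (a : R) u v, T u -> T v -> T (a *: u + v).

Lemma subspaceD T u v : subspace T -> T u -> T v -> T (u + v).
Proof. by move=> [_ TD] Tu Tv; rewrite -[u]scale1r; apply: TD. Qed.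

Lemma subspaceZ T (a : R) u : subspace T -> T u -> T (a *: u).
Proof. by move=> [T0 TD] Tu; rewrite -[_ *: u]addr0; apply: TD. Qed.

Lemma subspaceB T u v : subspace T -> T u -> T v -> T (u - v).
Proof.
by move=> sT Tu Tv; rewrite -scaleN1r; apply: subspaceD => //; apply: subspaceZ.
Qed.

Lemma subspace_sum T (I : finType) (F : I -> V) :
  subspace T -> (forall i, T (F i)) -> T (\sum_i F i).
Proof.
move=> sT TF; apply: (big_ind T) => //; first exact: sT.1.
by move=> u v; apply: subspaceD.
Qed.

Lemma lin_span_sub S T : subspace T -> S `<=` T -> lin_span S `<=` T.
Proof.
move=> sT ST v [m [a [s [Ss ->]]]].
by apply: subspace_sum => // i; apply: subspaceZ => //; apply: ST.
Qed.

Lemma mem_lin_span S v : S v -> lin_span S v.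
Proof.
move=> Sv; exists 1, (fun=> 1), (fun=> v); split=> //.
by rewrite big_ord1 scale1r.
Qed.

Lemma lin_span_set1 (x v : V) : lin_span [set x] v <-> exists a : R, v = a *: x.
Proof.
split=> [[m [a [s [sx ->]]]]|[a ->]].
  by exists (\sum_i a i); rewrite scaler_suml; apply: eq_bigr => i _; rewrite sx.
by exists 1, (fun=> a), (fun=> x); split=> //; rewrite big_ord1.
Qed.

Lemma subspace_comb k (b : 'I_k -> V) :
  subspace [set v | exists a : 'I_k -> R, v = \sum_i a i *: b i].
Proof.
split=> [|c u v [a1 ->] [a2 ->]].
  by exists (fun=> 0); rewrite big1 // => i _; rewrite scale0r.
exists (fun i => c * a1 i + a2 i).
rewrite scaler_sumr -big_split; apply: eq_bigr => i _ /=.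
by rewrite scalerA scalerDl.
Qed.

Lemma lin_spanP k (b : 'I_k -> V) v :
  lin_span (range b) v <-> exists a : 'I_k -> R, v = \sum_i a i *: b i.
Proof.
split; last by move=> [a ->]; exists k, a, b; split=> // i; exists i.
apply: (lin_span_sub (subspace_comb b)) => _ [i _ <-].
exists (fun j => (j == i)%:R).
rewrite (bigD1 i) //= eqxx scale1r big1 ?addr0 // => j /negPf ->.
by rewrite scale0r.
Qed.

Lemma subspace_span k (b : 'I_k -> V) : subspace (lin_span (range b)).
Proof.
have -> : lin_span (range b) =
    [set v | exists a : 'I_k -> R, v = \sum_i a i *: b i].
  by apply/seteqP; split=> v /lin_spanP.
exact: subspace_comb.
Qed.

Lemma basis_subspace k (b : 'I_k -> V) T : is_basis b T -> subspace T.
Proof. by move=> [_ ->]; apply: subspace_span. Qed.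

Lemma basis_mem k (b : 'I_k -> V) T i : is_basis b T -> T (b i).
Proof. by move=> [_ ->]; apply: mem_lin_span; exists i. Qed.

Lemma basisP k (b : 'I_k -> V) T v :
  is_basis b T -> (T v <-> exists a : 'I_k -> R, v = \sum_i a i *: b i).
Proof. by move=> [_ ->]; apply: lin_spanP. Qed.

(** Independence says that the matrix of coordinates of [b] in a basis of [T] has trivial left
    kernel. Being square, it is invertible, and its inverse expresses every vector of [T] through
    [b]. *)
Lemma lin_indep_basis k (b : 'I_k -> V) T :
  has_dim k T -> lin_indep b -> (forall i, T (b i)) -> is_basis b T.
Proof.
move=> [c cT] bI Tb; split=> //; apply/seteqP; split; last first.
  apply: lin_span_sub; first exact: basis_subspace cT.
  by move=> _ [i _ <-].
have /choice[A bA] i : exists a : 'I_k -> R, b i = \sum_j a j *: c j.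
  exact/(basisP _ cT).
pose B : 'M[R]_k := \matrix_(i, j) A i j.
have combM (u : 'rV_k) (F : 'I_k -> V) (C : 'M[R]_k) :
    \sum_j (u *m C) 0 j *: F j = \sum_i u 0 i *: \sum_j C i j *: F j.
  under eq_bigr do rewrite mxE scaler_suml.
  rewrite exchange_big /=; apply: eq_bigr => i _.
  by rewrite scaler_sumr; apply: eq_bigr => j _; rewrite scalerA.
have bE i : b i = \sum_j B i j *: c j.
  by rewrite bA; apply: eq_bigr => j _; rewrite mxE.
have Bu : B \in unitmx.
  rewrite -row_free_unit -kermx_eq0; apply/rowV0P => u /sub_kermxP uB0.
  apply/rowP => i; rewrite mxE; apply: (bI (u 0)).
  under eq_bigr do rewrite bE.
  by rewrite -combM uB0 big1 // => j _; rewrite mxE scale0r.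
move=> v /(basisP _ cT)[a ->]; apply/lin_spanP.
pose u : 'rV_k := \row_j a j.
exists ((u *m invmx B) 0).
under [RHS]eq_bigr do rewrite bE.
by rewrite -combM mulmxKV //; apply: eq_bigr => j _; rewrite mxE.
Qed.

Lemma lin_span_set1Z (x : V) (a : R) :
  a != 0 -> lin_span [set a *: x] = lin_span [set x].
Proof.
move=> a0; apply/seteqP; split=> v /lin_span_set1[b ->]; apply/lin_span_set1.
  by exists (b * a); rewrite scalerA.
by exists (b / a); rewrite scalerA divfK.
Qed.

Lemma lin_span_range1 (b : 'I_1 -> V) : lin_span (range b) = lin_span [set b 0].
Proof.
congr lin_span; apply/seteqP; split=> [_ [i _ <-]|_ ->]; last by exists 0.
by rewrite ord1.
Qed.

Lemma basis_direct_sum k (b : 'I_k -> V) (S : 'I_k -> set V) T :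
  is_basis b T -> (forall i, S i = lin_span [set b i]) -> is_direct_sum S T.
Proof.
move=> bT Sb; split=> [w Sw|v /(basisP _ bT)[a ->]].
  apply: subspace_sum => [|i]; first exact: basis_subspace bT.
  have := Sw i; rewrite Sb => /lin_span_set1[a ->].
  by apply: subspaceZ; [exact: basis_subspace bT|exact: basis_mem bT].
exists (fun i => a i *: b i); split.
  by split=> // i; rewrite Sb; apply/lin_span_set1; exists (a i).
move=> w [Sw aw]; have /choice[c wc] i : exists c : R, w i = c *: b i.
  by apply/lin_span_set1; rewrite -Sb.
have {}aw : \sum_i (a i - c i) *: b i = 0.
  under eq_bigr do rewrite scalerBl -wc.
  by rewrite sumrB aw subrr.
apply/funext => i; rewrite wc; congr (_ *: _).
by apply/eqP; rewrite -subr_eq0; apply/eqP/(bT.1 (fun i => a i - c i)).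
Qed.

(** Tangent vectors are functionals, so this supplies a nonzero 2 by 2 determinant made of values on
    two test functions. It replaces coordinates in the use of Cramer's rule. *)
Lemma lin_indep2_minor (T : Type) (u v : T -> R) :
  (forall a b : R, a *: u + b *: v = 0 -> a = 0 /\ b = 0) ->
  exists f g, u f * v g - u g * v f != 0.
Proof.
move=> uv; have nz (w : T -> R) : w <> 0 -> exists f, w f != 0.
  move=> w0; apply: contrapT => wf; apply: w0; apply/funext => f.
  by apply/eqP/negPn/negP => f0; apply: wf; exists f.
have [f uf] : exists f, u f != 0.
  apply: nz => u0; have [|/eqP] := uv 1 0; last by rewrite oner_eq0.
  by rewrite u0 scaler0 scale0r addr0.
(* This combination is nonzero because its second coefficient [u f] is; its value at [g] is exactly
   the minor. *)
have [g] : exists g, ((- v f) *: u + u f *: v) g != 0.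
  by apply: nz => /uv[_ /eqP]; rewrite (negPf uf).
rewrite -[_ g]/(- v f * u g + u f * v g) => uvg; exists f, g.
suff <- : - v f * u g + u f * v g = u f * v g - u g * v f by [].
by ring.
Qed.

End LinearSpan.

(** * Differentiability of order k on open subsets of R^n *)

Section SmoothFunctions.
Variables (R : realType) (n : nat).
Implicit Types (U : set 'rV[R]_n) (f g : 'rV[R]_n -> R) (k : nat).

Lemma C_cst k U (a : R) : C_ k U (cst a).
Proof.
have cc (b : R) x : {for x, continuous (cst b : 'rV[R]_n -> R)}.
  exact: (@cvg_cst _ b 'rV[R]_n (nbhs x)).
elim: k a => [|k IH] a; split=> // i.
split=> [x _|]; first exact: derivable_cst.
rewrite (_ : (fun x => _) = cst 0) //.
by apply/funext => x; rewrite derive_cst.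
Qed.

Lemma C_sub k U U' f : U' `<=` U -> C_ k U f -> C_ k U' f.
Proof.
move=> sU; elim: k f => [|k IH] f /= [cf df]; first by split=> // x /sU; exact: cf.
split=> [x /sU|i]; first exact: cf.
by have [df1 df2] := df i; split=> [x /sU|]; [apply: df1|apply: IH].
Qed.

Lemma C_pred k U f : C_ k.+1 U f -> C_ k U f.
Proof.
elim: k f => [|k IH] f [cf df]; split=> // i.
by have [df1 df2] := df i; split=> //; apply: IH.
Qed.

Lemma continuous_near_eq f g x : {near x, f =1 g} ->
  {for x, continuous f} -> {for x, continuous g}.
Proof.
move=> fg cf; have fgx := nbhs_singleton fg.
by apply: cvg_trans (near_eq_cvg fg) _; rewrite -fgx.
Qed.

(** As [U] is open, [f] and [g] agree near each of its points, so their partial derivatives agree on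
    [U] and the induction goes on with those. *)
Lemma C_eq k U f g : open U -> (forall x, U x -> f x = g x) ->
  C_ k U f -> C_ k U g.
Proof.
move=> oU; elim: k f g => [|k IH] f g fg /= [cf df].
  split=> // x Ux; apply: continuous_near_eq (cf x Ux).
  by near do apply: fg; exact: open_nbhs_nbhs.
have nfg x : U x -> {near x, f =1 g}.
  by move=> Ux; near do apply: fg; exact: open_nbhs_nbhs.
split=> [x Ux|i]; first exact: continuous_near_eq (nfg x Ux) (cf x Ux).
have [df1 df2] := df i; split=> [x Ux|].
  by apply: (near_eq_derivable (nfg x Ux)); exact: df1.
apply: IH df2 => x Ux; exact/near_eq_derive/nfg.
Unshelve. all: by end_near.
Qed.

Lemma C_add k U f g : open U -> C_ k U f -> C_ k U g -> C_ k U (f \+ g).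
Proof.
move=> oU; elim: k f g => [|k IH] f g /= [cf df] [cg dg].
  by split=> // x Ux; exact: (cvgD (cf x Ux) (cg x Ux)).
split=> [x Ux|i]; first by exact: (cvgD (cf x Ux) (cg x Ux)).
have [df1 df2] := df i; have [dg1 dg2] := dg i; split=> [x Ux|].
  by apply: derivableD; [exact: df1|exact: dg1].
apply: C_eq (IH _ _ df2 dg2) => // x Ux /=.
by rewrite deriveD //; [exact: df1|exact: dg1].
Qed.

Lemma C_mul k U f g : open U -> C_ k U f -> C_ k U g -> C_ k U (f \* g).
Proof.
move=> oU; elim: k f g => [|k IH] f g Cf Cg.
  by split=> // x Ux; exact: (cvgM (Cf.1 x Ux) (Cg.1 x Ux)).
have [cf df] := Cf; have [cg dg] := Cg.
split=> [x Ux|i]; first by exact: (cvgM (cf x Ux) (cg x Ux)).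
have [df1 df2] := df i; have [dg1 dg2] := dg i; split=> [x Ux|].
  by apply: derivableM; [exact: df1|exact: dg1].
(* The product rule leaves one factor undifferentiated; [C_pred] lowers its order to that of the
   other factor. *)
apply: C_eq (C_add oU (IH _ _ (C_pred Cf) dg2) (IH _ _ (C_pred Cg) df2)) => //.
by move=> x Ux /=; rewrite deriveM //; [exact: df1|exact: dg1].
Qed.

End SmoothFunctions.

(** * Smooth germs, tangent vectors and vector fields *)

Section Germs.
Variables (R : realType) (n : nat) (M : smoothManifold R n).
Implicit Types (p : M) (U : set M) (f g : M -> R).
Implicit Types (X Y Z : M -> (M -> R) -> R) (D E : M -> set ((M -> R) -> R)).

(** On the open set of all chart values, continuity of [chart_inv c] within the set is ordinary
    continuity. The preimage of [U] is therefore a neighbourhood of each point of the image.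
    Smoothness of sums and products in charts relies on this openness. *)
Lemma open_chart_img (c : chart R n M) U :
  open U -> open (chart_fun c @` (chart_dom c `&` U)).
Proof.
move=> oU; have oI := @chart_img_open _ _ _ c.
have := @chart_inv_cts _ _ _ c; rewrite continuous_open_subspace // => inv_c.
rewrite openE => _ [q [cq Uq] <-].
have Iq : (chart_fun c @` chart_dom c) (chart_fun c q) by exists q.
have : nbhs (chart_fun c q) (chart_inv c @^-1` U).
  apply: (inv_c (chart_fun c q)); first exact/mem_set.
  by rewrite chart_funK //; exact: open_nbhs_nbhs.
have : nbhs (chart_fun c q) (chart_fun c @` chart_dom c).
  exact: open_nbhs_nbhs.
apply: filterS2 => _ [r cr <-] /=; rewrite chart_funK // => Ur.
by exists r.
Qed.

Lemma smooth_on_sub U U' f : U' `<=` U -> smooth_on U f -> smooth_on U' f.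
Proof.
move=> sU Uf c Ac k; apply: C_sub (Uf c Ac k).
by move=> _ [q [cq /sU Uq] <-]; exists q.
Qed.

Lemma smooth_on_at U p f : open U -> U p -> smooth_on U f -> smooth_at f p.
Proof. by exists U. Qed.

Lemma smooth_at_near_cst p (a : R) f :
  (exists2 U, open_nbhs p U & forall q, U q -> f q = a) -> smooth_at f p.
Proof.
move=> [U [oU Up] fU]; exists U => // c Ac k.
apply: C_eq (C_cst k _ a) => [|_ [q [cq Uq] <-] /=]; first exact: open_chart_img.
by rewrite chart_funK ?fU.
Qed.

Lemma smooth_at_cst p (a : R) : smooth_at (cst a : M -> R) p.
Proof.
apply: (@smooth_at_near_cst p a); exists setT => //.
by split=> //; exact: openT.
Qed.

Lemma smooth_at2 p f g : smooth_at f p -> smooth_at g p ->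
  exists U, [/\ open_nbhs p U, smooth_on U f & smooth_on U g].
Proof.
move=> [U [oU Up] Uf] [U' [oU' Up'] Ug]; exists (U `&` U'); split.
- by split=> //; exact: openI.
- exact: smooth_on_sub Uf.
- exact: smooth_on_sub Ug.
Qed.

Lemma smooth_atD p f g : smooth_at f p -> smooth_at g p ->
  smooth_at (fun q => f q + g q) p.
Proof.
move=> fp gp; have [U [[oU Up] Uf Ug]] := smooth_at2 fp gp.
exists U => // c Ac k.
have oI := open_chart_img (c := c) oU; exact: (C_add oI (Uf c Ac k) (Ug c Ac k)).
Qed.

Lemma smooth_atM p f g : smooth_at f p -> smooth_at g p ->
  smooth_at (fun q => f q * g q) p.
Proof.
move=> fp gp; have [U [[oU Up] Uf Ug]] := smooth_at2 fp gp.
exists U => // c Ac k.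
have oI := open_chart_img (c := c) oU; exact: (C_mul oI (Uf c Ac k) (Ug c Ac k)).
Qed.

Lemma smooth_atZ p (a : R) f : smooth_at f p -> smooth_at (fun q => a * f q) p.
Proof. by move=> fp; apply: smooth_atM fp; apply: smooth_at_cst. Qed.

Lemma smooth_atN p f : smooth_at f p -> smooth_at (fun q => - f q) p.
Proof.
by move=> fp; under eq_fun do rewrite -mulN1r; exact: smooth_atZ.
Qed.

Lemma smooth_atB p f g : smooth_at f p -> smooth_at g p ->
  smooth_at (fun q => f q - g q) p.
Proof. by move=> fp gp; apply: smooth_atD fp (smooth_atN gp). Qed.

Lemma smooth_at_near p f : smooth_at f p ->
  exists2 U, open_nbhs p U & forall q, U q -> smooth_at f q.
Proof. by move=> [U oU Uf]; exists U => // q Uq; exists U => //; case: oU. Qed.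

(* A function vanishing near p is its product with the indicator function of the
   complement of a neighbourhood of p, which is smooth at p. *)
Lemma tangent_near0 p v f : tangent p v ->
  (exists2 U, open_nbhs p U & forall q, U q -> f q = 0) -> v f = 0.
Proof.
move=> [_ _ vM] [U oU fU].
pose h q : R := if q \in U then 0 else 1.
have hU q : U q -> h q = 0 by rewrite /h => /mem_set ->.
have Up : U p by case: oU.
have -> : f = (fun q => h q * f q).
  apply/funext => q; rewrite /h; case: ifPn => [/set_mem/fU ->|_].
    by rewrite mulr0.
  by rewrite mul1r.
rewrite vM.
- by rewrite hU // fU // !mul0r addr0.
- by apply: (@smooth_at_near_cst p 0); exists U.
- by apply: (@smooth_at_near_cst p 0); exists U.
Qed.

Lemma tangentD p v f g : tangent p v -> smooth_at f p -> smooth_at g p ->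
  v (fun q => f q + g q) = v f + v g.
Proof.
move=> [_ vD _] fp gp; rewrite -[v f]mul1r -vD //; congr v.
by apply/funext => q; rewrite mul1r.
Qed.

Lemma tangentZ p v (a : R) f : tangent p v -> smooth_at f p ->
  v (fun q => a * f q) = a * v f.
Proof.
move=> Tv fp; have v0 : v (cst 0) = 0.
  by apply: (tangent_near0 Tv); exists setT => //; split=> //; exact: openT.
have [_ vD _] := Tv; rewrite -[RHS]addr0 -v0 -vD //.
  by congr v; apply/funext => q; rewrite addr0.
exact: smooth_at_cst.
Qed.

Lemma tangentB p v f g : tangent p v -> smooth_at f p -> smooth_at g p ->
  v (fun q => f q - g q) = v f - v g.
Proof.
move=> Tv fp gp; rewrite (tangentD Tv) //; last exact: smooth_atN.
rewrite -[in RHS]mulN1r -(tangentZ _ Tv) //; congr (_ + v _).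
by apply/funext => q; rewrite mulN1r.
Qed.

Lemma subspace_tangent p : subspace (@tangent _ _ M p).
Proof.
split; first by split=> // *; rewrite /= ?mulr0 ?addr0.
move=> a u v [u0 uD uM] [v0 vD vM]; split=> [f|b f g|f g] fp.
- change (a * u f + v f = 0).
  by rewrite u0 // v0 // mulr0 addr0.
- move=> gp; change (a * u (fun q => b * f q + g q) + v (fun q => b * f q + g q)
    = b * (a * u f + v f) + (a * u g + v g)).
  by rewrite uD // vD //; ring.
move=> gp; change (a * u (fun q => f q * g q) + v (fun q => f q * g q)
    = f p * (a * u g + v g) + g p * (a * u f + v f)).
by rewrite uM // vM //; ring.
Qed.

Lemma tangent_smooth_at p v f : tangent p v -> v f != 0 -> smooth_at f p.
Proof. by move=> [v0 _ _] vf; apply: contrapT => /v0/eqP; apply/negP. Qed.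

Lemma smooth_vfield_sub U U' X :
  U' `<=` U -> smooth_vfield U X -> smooth_vfield U' X.
Proof. by move=> sU UX q /sU; apply: UX. Qed.

Lemma smooth_vfieldZD U (g : M -> R) X Y :
  (forall q, U q -> smooth_at g q) -> smooth_vfield U X -> smooth_vfield U Y ->
  smooth_vfield U (fun q => g q *: X q + Y q).
Proof.
move=> Ug UX UY q Uq; have [TX sX] := UX q Uq; have [TY sY] := UY q Uq.
split=> [|f fq]; first exact: (subspace_tangent q).2.
by apply: smooth_atD (sY f fq); apply: smooth_atM (sX f fq); apply: Ug.
Qed.

Lemma smooth_vfield0 U : smooth_vfield U (fun=> 0 : (M -> R) -> R).
Proof.
move=> q _; split=> [|f _]; first exact: (subspace_tangent q).1.
exact: smooth_at_cst.
Qed.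

(** * Lie brackets, sections of distributions and local frames *)

Lemma lie_bracketC X Y p : lie_bracket X Y p = - lie_bracket Y X p.
Proof.
apply/funext => f; change (lie_bracket X Y p f = - (lie_bracket Y X p f)).
by rewrite /lie_bracket; case: ifP => _; rewrite ?opprB ?oppr0.
Qed.

Lemma lie_bracketZD U p (g : M -> R) X Y Z : U p -> smooth_at g p ->
  smooth_vfield U X -> smooth_vfield U Y -> smooth_vfield U Z ->
  lie_bracket X (fun q => g q *: Y q + Z q) p =
  g p *: lie_bracket X Y p + X p g *: Y p + lie_bracket X Z p.
Proof.
move=> Up gp UX UY UZ; apply/funext => f.
have [TX sX] := UX p Up; have [TY sY] := UY p Up; have [TZ sZ] := UZ p Up.
change (lie_bracket X (fun q => g q *: Y q + Z q) p f =
  g p * lie_bracket X Y p f + X p g * Y p f + lie_bracket X Z p f).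
(* If [f] is not smooth at [p], the brackets are zero by definition, and the derivative term is zero
   because the tangent vector [Y p] vanishes on [f]. *)
rewrite /lie_bracket; case: asboolP => [fp|nfp]; last first.
  by case: TY => [Y0 _ _]; rewrite Y0 // !mulr0 !addr0.
change (X p (fun q => g q * Y q f + Z q f) - (g p * Y p (vf_app X f) + Z p (vf_app X f))
 = g p * (X p (vf_app Y f) - Y p (vf_app X f)) + X p g * Y p f +
   (X p (vf_app Z f) - Z p (vf_app X f))).
have gY : smooth_at (fun q => g q * Y q f) p by apply: smooth_atM (sY f fp).
rewrite (tangentD TX gY (sZ f fp)); case: TX => [_ _ XM].
by rewrite XM //; [rewrite /vf_app; ring|exact: sY].
Qed.

(** [Y] may be nonzero away from [p]; locality of tangent vectors takes care of this. An identity
    between fields that holds only near [p] can thus be bracketed with [X]. *)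
Lemma lie_bracket_near0 U p X Y : open_nbhs p U -> smooth_vfield U X ->
  (forall q, U q -> Y q = 0) -> lie_bracket X Y p = 0.
Proof.
move=> [oU Up] UX Y0; apply/funext => f; change (lie_bracket X Y p f = 0).
rewrite /lie_bracket; case: asboolP => // fp; rewrite Y0 //.
rewrite (tangent_near0 (UX p Up).1); first by rewrite subr0.
by exists U => // q Uq; rewrite /vf_app Y0.
Qed.

Lemma is_section_sub D U U' X :
  U' `<=` U -> is_section D U X -> is_section D U' X.
Proof.
move=> sU [UX DX]; split=> [|q /sU]; last exact: DX.
exact: smooth_vfield_sub UX.
Qed.

Lemma is_sectionZD D U (g : M -> R) X Y : (forall p, subspace (D p)) ->
  (forall q, U q -> smooth_at g q) -> is_section D U X -> is_section D U Y ->
  is_section D U (fun q => g q *: X q + Y q).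
Proof.
move=> sD Ug [UX DX] [UY DY]; split; first exact: smooth_vfieldZD.
by move=> q Uq; apply: (sD q).2; [exact: DX|exact: DY].
Qed.

Lemma bracket_distP D E U X Y p : open_nbhs p U -> is_section D U X ->
  is_section E U Y -> bracket_dist D E p (lie_bracket X Y p).
Proof. by move=> oU DX EY; apply: mem_lin_span; exists U, X, Y. Qed.

Lemma plane_field_subspace k D p : plane_field k D -> subspace (D p).
Proof. by move=> /(_ p)[U [X [[_ Up] _ /(_ p Up)/basis_subspace]]]. Qed.


Lemma tangent_near_eq p v f g : tangent p v -> smooth_at f p -> smooth_at g p ->
  (exists2 U, open_nbhs p U & forall q, U q -> f q = g q) -> v f = v g.
Proof.
move=> Tv fp gp [U oU fg]; apply/eqP; rewrite -subr_eq0 -(tangentB Tv) //.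
apply/eqP/(tangent_near0 Tv); exists U => // q /fg ->; exact: subrr.
Qed.

(** The linearity and Leibniz rules for [vf_app] hold only near [p], where [f] and [g] stay smooth,
    so they enter through [tangent_near_eq]. In the Leibniz rule for the bracket, the products of
    first derivatives are symmetric in [X] and [Y] and cancel. *)
Lemma tangent_lie_bracket U p X Y : open_nbhs p U -> smooth_vfield U X ->
  smooth_vfield U Y -> tangent p (lie_bracket X Y p).
Proof.
move=> [oU Up] UX UY; have [TX sX] := UX p Up; have [TY sY] := UY p Up.
have lb f : smooth_at f p ->
    lie_bracket X Y p f = X p (vf_app Y f) - Y p (vf_app X f).
  by move=> fp; rewrite /lie_bracket asboolT.
have appD Z (a : R) f g : smooth_vfield U Z -> smooth_at f p -> smooth_at g p ->
    exists2 U', open_nbhs p U' & forall q, U' q ->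
      vf_app Z (fun r => a * f r + g r) q = a * vf_app Z f q + vf_app Z g q.
  move=> UZ fp gp; have [U' [oU' Uf Ug]] := smooth_at2 fp gp.
  exists (U `&` U') => [|q [Uq U'q]]; first exact: open_nbhsI.
  have [[_ ZD _] _] := UZ q Uq.
  by apply: ZD; [apply: smooth_on_at Uf|apply: smooth_on_at Ug]; case: oU'.
have appM Z f g : smooth_vfield U Z -> smooth_at f p -> smooth_at g p ->
    exists2 U', open_nbhs p U' & forall q, U' q ->
      vf_app Z (fun r => f r * g r) q = f q * vf_app Z g q + g q * vf_app Z f q.
  move=> UZ fp gp; have [U' [oU' Uf Ug]] := smooth_at2 fp gp.
  exists (U `&` U') => [|q [Uq U'q]]; first exact: open_nbhsI.
  have [[_ _ ZM] _] := UZ q Uq.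
  by apply: ZM; [apply: smooth_on_at Uf|apply: smooth_on_at Ug]; case: oU'.
split=> [f nfp|a f g fp gp|f g fp gp].
- by rewrite /lie_bracket asboolF.
- have fgp : smooth_at (fun r => a * f r + g r) p.
    by apply: smooth_atD gp; apply: smooth_atZ.
  have [_ XD _] := TX; have [_ YD _] := TY; rewrite !lb //.
  rewrite (tangent_near_eq TX (sY _ fgp) _ (appD Y a f g UY fp gp)); last first.
    by apply: smooth_atD (sY _ gp); apply/smooth_atZ/sY.
  rewrite (tangent_near_eq TY (sX _ fgp) _ (appD X a f g UX fp gp)); last first.
    by apply: smooth_atD (sX _ gp); apply/smooth_atZ/sX.
  rewrite XD ?YD //; try (by [apply: sX|apply: sY]).
  by ring.
have fgp := smooth_atM fp gp.
have sf Z : (forall f, smooth_at f p -> smooth_at (vf_app Z f) p) ->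
  [/\ smooth_at (fun q => f q * vf_app Z g q) p &
      smooth_at (fun q => g q * vf_app Z f q) p].
  by move=> sZ; split; apply: smooth_atM => //; apply: sZ.
have [sY1 sY2] := sf Y sY; have [sX1 sX2] := sf X sX.
have [_ _ XM] := TX; have [_ _ YM] := TY; rewrite !lb //.
rewrite (tangent_near_eq TX (sY _ fgp) (smooth_atD sY1 sY2) (appM Y f g UY fp gp)).
rewrite (tangent_near_eq TY (sX _ fgp) (smooth_atD sX1 sX2) (appM X f g UX fp gp)).
rewrite (tangentD TX) // (tangentD TY) // !XM // ?YM //; try (by [apply: sX|apply: sY]).
by rewrite /vf_app; ring.
Qed.

Lemma lie_bracket0 U p X : open_nbhs p U -> smooth_vfield U X ->
  lie_bracket X (fun=> 0) p = 0.
Proof. by move=> oU UX; apply: lie_bracket_near0 UX _. Qed.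

Lemma plane_field_neq0 k D p : plane_field k.+1 D ->
  exists U X, [/\ open_nbhs p U, is_section D U X & X p <> 0].
Proof.
move=> /(_ p)[U [X [[oU Up] DX bX]]]; exists U, (X 0); split=> // X0.
have [/(_ (fun i => (i == 0)%:R)) bI _] := bX p Up.
suff /bI/(_ 0)/eqP : \sum_i (i == 0)%:R *: X i p = 0.
  by rewrite eqxx oner_eq0.
by rewrite big_ord_recl X0 scaler0 add0r big1 // => i _; rewrite scale0r.
Qed.

(* For sections X, Y of D and a function f, X(f) Y = [X, fY] - f [X, Y]. *)
Lemma plane_field_sub_bracket k D p : plane_field k.+1 D ->
  subspace (bracket_dist D D p) -> D p `<=` bracket_dist D D p.
Proof.
move=> pD sE v Dv; have sD q : subspace (D q) := plane_field_subspace q pD.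
have [U [X [oU DX X0]]] := plane_field_neq0 p pD.
have [f Xf] : exists f, X p f != 0.
  apply: contrapT => Xf; apply: X0; apply/funext => f.
  by apply/eqP/negPn/negP => f0; apply: Xf; exists f.
have TX : tangent p (X p) by apply: (DX.1 p _).1; case: oU.
have fp := tangent_smooth_at TX Xf.
have [U1 oU1 Uf] := smooth_at_near fp.
have [U2 [Y [oU2 DY bY]]] := pD p.
have [a ->] := (basisP _ (bY p oU2.2)).1 Dv.
apply: subspace_sum => // i; apply: subspaceZ => //.
pose O := U `&` U1 `&` U2.
have oO : open_nbhs p O by do 2?apply: open_nbhsI.
have OX : is_section D O X by apply: is_section_sub DX => q [[]].
have OY : is_section D O (Y i) by apply: is_section_sub (DY i) => q [].
have O0 : is_section D O (fun=> 0).
  by split=> [|q _]; [exact: smooth_vfield0|exact: (sD q).1].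
(* The zero section is added to match the form g Y + Z in [lie_bracketZD]. *)
have OfY : is_section D O (fun q => f q *: Y i q + 0).
  by apply: is_sectionZD => // q [[_ /Uf]].
have := lie_bracketZD oO.2 fp OX.1 OY.1 O0.1.
rewrite (lie_bracket0 oO OX.1) addr0 => /esym/(canRL (addKr _)) XfY.
rewrite -[Y i p](scalerK Xf); apply: subspaceZ => //; rewrite XfY.
apply: subspaceD => //; last exact: bracket_distP oO OX OfY.
rewrite -scaleNr; apply: subspaceZ => //; exact: bracket_distP oO OX OY.
Qed.

(* Cramer's rule, with the determinant g kept on the left-hand side. *)
Lemma plane_field_cramer D p : plane_field 2 D ->
  exists U e1 e2 g, [/\ open_nbhs p U, is_section D U e1, is_section D U e2,
    g p != 0 & [/\ forall q, U q -> smooth_at g q &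
    forall U' Y, U' `<=` U -> is_section D U' Y -> exists P Q,
      [/\ forall q, U' q -> smooth_at P q, forall q, U' q -> smooth_at Q q &
          forall q, U' q -> g q *: Y q = P q *: e1 q + Q q *: e2 q]]].
Proof.
have l1 : lift ord0 ord0 = 1 :> 'I_2 by apply: val_inj.
move=> /(_ p)[U [e [oU De be]]].
have [f1 [f2 df]] : exists f g,
    e 0 p f * e 1 p g - e 0 p g * e 1 p f != 0.
  apply: lin_indep2_minor => a b ab.
  have [+ _] := be p oU.2 => /(_ (fun i => nth 0 [:: a; b] i)).
  rewrite big_ord_recl big_ord1 l1 => /(_ ab) nab.
  by split; [exact: (nab 0)|exact: (nab 1)].
have Te i : tangent p (e i p) := ((De i).1 p oU.2).1.
(* Tangent vectors vanish on functions not smooth at [p], so a nonzero minor forces both test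
   functions to be smooth there. *)
have f1p : smooth_at f1 p.
  apply: contrapT => nf1; move/eqP: df; apply.
  by have [e0 _ _] := Te 0; have [e1 _ _] := Te 1; rewrite (e0 f1) // (e1 f1) // mul0r mulr0 subrr.
have f2p : smooth_at f2 p.
  apply: contrapT => nf2; move/eqP: df; apply.
  by have [e0 _ _] := Te 0; have [e1 _ _] := Te 1; rewrite (e0 f2) // (e1 f2) // mul0r mulr0 subrr.
have [U1 oU1 Uf1] := smooth_at_near f1p; have [U2 oU2 Uf2] := smooth_at_near f2p.
pose O := U `&` (U1 `&` U2).
have oO : open_nbhs p O by do 2?apply: open_nbhsI.
pose minor Y Z q := Y q f1 * Z q f2 - Y q f2 * Z q f1.
have s_minor U' Y Z : U' `<=` O -> smooth_vfield U' Y -> smooth_vfield U' Z ->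
    forall q, U' q -> smooth_at (minor Y Z) q.
  move=> sU' UY UZ q Uq; have [_ [/Uf1 s1 /Uf2 s2]] := sU' q Uq.
  have [_ sY] := UY q Uq; have [_ sZ] := UZ q Uq.
  by apply: smooth_atB; apply: smooth_atM; [apply: sY|apply: sZ|apply: sY|apply: sZ].
have De' i : is_section D O (e i) by apply: is_section_sub (De i) => q [].
exists O, (e 0), (e 1), (minor (e 0) (e 1)); split=> //; split=> [|U' Y sU' DY].
  exact: (s_minor O _ _ _ (De' 0).1 (De' 1).1).
have Ue i : smooth_vfield U' (e i) := smooth_vfield_sub sU' (De' i).1.
(* The numerators of Cramer's rule: [Y] replaces the first, respectively the second, vector of the
   frame. *)
exists (minor Y (e 1)), (minor (e 0) Y); split.
- exact: s_minor DY.1 (Ue 1).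
- exact: s_minor (Ue 0) DY.1.
move=> q Uq; have [Oq _] := sU' q Uq.
have [a] := (basisP _ (be q Oq)).1 (DY.2 q Uq).
rewrite big_ord_recl big_ord1 l1 => Yq.
have YE f : Y q f = a 0 * e 0 q f + a 1 * e 1 q f by rewrite Yq.
apply/funext => f; change (minor (e 0) (e 1) q * Y q f =
  minor Y (e 1) q * e 0 q f + minor (e 0) Y q * e 1 q f).
by rewrite /minor !YE; ring.
Qed.

End Germs.

(** * One-forms and almost complex structures *)

Section OneForms.
Variables (R : realType) (n : nat) (M : smoothManifold R n).
Implicit Types (p : M) (alpha : M -> ((M -> R) -> R) -> R).
Implicit Types (E : M -> set ((M -> R) -> R)).

Lemma one_formZ alpha p (a : R) u : one_form alpha -> tangent p u ->
  alpha p (a *: u) = a * alpha p u.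
Proof.
move=> [aD _] Tu; have T0 := (subspace_tangent p).1.
have a0 : alpha p 0 = 0.
  have := aD p 1 0 0 T0 T0; rewrite scale1r addr0 mul1r => /eqP.
  by rewrite -subr_eq0 opprD addNKr oppr_eq0 => /eqP.
by rewrite -[a *: u]addr0 aD // a0 addr0.
Qed.

Lemma one_formD alpha p u v : one_form alpha -> tangent p u -> tangent p v ->
  alpha p (u + v) = alpha p u + alpha p v.
Proof. by move=> [aD _] Tu Tv; rewrite -{1}[u]scale1r aD // mul1r. Qed.

Lemma one_formN alpha p u : one_form alpha -> tangent p u ->
  alpha p (- u) = - alpha p u.
Proof. by move=> fa Tu; rewrite -scaleN1r one_formZ // mulN1r. Qed.

Lemma one_formB alpha p u v : one_form alpha -> tangent p u -> tangent p v ->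
  alpha p (u - v) = alpha p u - alpha p v.
Proof.
move=> fa Tu Tv; rewrite one_formD // ?one_formN //.
by rewrite -scaleN1r; apply: subspaceZ => //; exact: subspace_tangent.
Qed.

Lemma one_form0 alpha p : one_form alpha -> alpha p 0 = 0.
Proof.
move=> fa; rewrite -(scale0r (0 : (M -> R) -> R)) one_formZ ?mul0r //.
exact: (subspace_tangent p).1.
Qed.

Lemma subspace_kernel alpha p : one_form alpha ->
  subspace [set v | tangent p v /\ alpha p v = 0].
Proof.
move=> fa; have sT := subspace_tangent p; split; first by split; [exact: sT.1|exact: one_form0].
move=> a u v [Tu au] [Tv av]; split; first exact: sT.2.
by rewrite fa.1 // au av mulr0 addr0.
Qed.

Section AlmostComplex.
Variable J : M -> ((M -> R) -> R) -> ((M -> R) -> R).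
Hypothesis J_ac : almost_complex J.

Lemma tangentJ p v : tangent p v -> tangent p (J p v).
Proof. by case: J_ac => [JT _ _ _]; exact: JT. Qed.

Lemma almost_complexZ p (a : R) v : tangent p v -> J p (a *: v) = a *: J p v.
Proof.
case: J_ac => [_ JD _ _] Tv; have T0 := (subspace_tangent p).1.
have J0 : J p 0 = 0.
  have := JD p 1 0 0 T0 T0; rewrite !scale1r addr0 => /eqP.
  by rewrite -subr_eq0 opprD addNKr oppr_eq0 => /eqP.
by rewrite -[a *: v]addr0 JD // J0 addr0.
Qed.

Lemma one_form_comp alpha : one_form alpha -> one_form (form_comp alpha J).
Proof.
case: J_ac => [JT JD _ sJ] [aD sa]; split=> [p a u v Tu Tv|U X oU UX p Up].
  by rewrite /form_comp JD // aD //; exact: JT.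
by apply: (sa U (fun q => J q (X q)) oU _ p Up); exact: sJ.
Qed.

(** Applying J to the relation gives a second one, a Jw - b w = 0. Eliminating Jw leaves (a^2 + b^2)
    w = 0. *)
Lemma almost_complex_indep p w (a b : R) : tangent p w -> w <> 0 ->
  a *: w + b *: J p w = 0 -> a = 0 /\ b = 0.
Proof.
move=> Tw w0 e1; have [_ JD JJ _] := J_ac; have sT := subspace_tangent p.
have JTw := tangentJ Tw.
have e2 : a *: J p w - b *: w = 0.
  rewrite -scalerN -(JJ _ _ Tw) -(almost_complexZ _ JTw) -JD //.
    by rewrite e1 -(scale0r w) almost_complexZ // !scale0r.
  exact: subspaceZ.
have : (a ^+ 2 + b ^+ 2) *: w = 0.
  have -> : (a ^+ 2 + b ^+ 2) *: w =
      a *: (a *: w + b *: J p w) - b *: (a *: J p w - b *: w).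
    rewrite scalerDr scalerBr !scalerA (mulrC b a) opprB addrACA subrr.
    by rewrite addr0 scalerDl !expr2.
  by rewrite e1 e2 !scaler0 subr0.
move=> /eqP; rewrite scaler_eq0 => /orP[|/eqP//].
by rewrite paddr_eq0 ?sqr_ge0 // !sqrf_eq0 => /andP[/eqP-> /eqP->].
Qed.

Lemma J_image_line p x : tangent p x ->
  J p @` lin_span [set x] = lin_span [set J p x].
Proof.
move=> Tx; apply/seteqP; split=> [_ [_ /lin_span_set1[a ->] <-]|v].
  by apply/lin_span_set1; exists a; rewrite almost_complexZ.
move=> /lin_span_set1[a ->]; exists (a *: x); last by rewrite almost_complexZ.
by apply/lin_span_set1; exists a.
Qed.

End AlmostComplex.
End OneForms.

(** * J-Engel structures and their associated vector fields *)

Section JEngel.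
Variables (R : realType) (n : nat) (M : smoothManifold R n).
Variables (J : M -> ((M -> R) -> R) -> ((M -> R) -> R)).
Variables (D : M -> set ((M -> R) -> R)).
Hypotheses (J_ac : almost_complex J) (D_engel : J_engel J D).

Local Notation E := (bracket_dist D D).
Local Notation vfield := (M -> (M -> R) -> R).

Let pD : plane_field 2 D. Proof. by case: D_engel => [[]]. Qed.
Let sD p : subspace (D p). Proof. exact: plane_field_subspace pD. Qed.

Section DefiningForm.
Variable alpha : M -> ((M -> R) -> R) -> R.
Hypothesis alphaE : defining_form E alpha.
Local Notation beta := (form_comp alpha J).

Let fa : one_form alpha. Proof. by case: alphaE. Qed.
Let fb : one_form beta. Proof. exact: one_form_comp. Qed.

Lemma bracket_distE p v : E p v <-> tangent p v /\ alpha p v = 0.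
Proof. by rewrite alphaE.2. Qed.

Lemma subspace_bracket_dist p : subspace (E p).
Proof. by rewrite alphaE.2; exact: subspace_kernel. Qed.

Lemma engel_sub p : D p `<=` E p.
Proof. exact: plane_field_sub_bracket pD (subspace_bracket_dist p). Qed.

Lemma engel_tangent p v : D p v -> tangent p v.
Proof. by move=> /engel_sub/bracket_distE[]. Qed.

Lemma engel_form p v : D p v -> alpha p v = 0.
Proof. by move=> /engel_sub/bracket_distE[]. Qed.

Lemma engel_formJ p v : D p v -> beta p v = 0.
Proof.
move=> Dv; apply: engel_form; have [_ <-] := D_engel.
by exists v.
Qed.

Section AssociatedField.
Variable X : vfield.
Hypothesis X_assoc : associated_vfield J alpha X.

Lemma assoc_tangent p : tangent p (X p).
Proof. by have [sX _ _ _] := X_assoc; exact: (sX p I).1. Qed.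

Lemma assoc_form p : alpha p (X p) = 1.
Proof. by case: X_assoc => _ _ bX aX; exact: aX. Qed.

Lemma assoc_formJ p : beta p (X p) = 0.
Proof. by case: X_assoc => _ _ bX aX; exact: bX. Qed.

Lemma assoc_formJJ p : beta p (J p (X p)) = -1.
Proof.
have [_ _ JJ _] := J_ac; have TX := assoc_tangent p.
by rewrite /form_comp JJ // one_formN // assoc_form.
Qed.

Lemma assoc_J_bracket p : E p (J p (X p)).
Proof.
apply/bracket_distE; split; last exact: assoc_formJ.
by apply: tangentJ => //; exact: assoc_tangent.
Qed.

(* D and JX(p) together span a 3-dimensional subspace of E(p), hence E(p). *)
Lemma engel_kernel p v :
  D p v <-> [/\ tangent p v, alpha p v = 0 & beta p v = 0].
Proof.
split=> [Dv|[Tv av bv]].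
  by split; [exact: engel_tangent|exact: engel_form|exact: engel_formJ].
have [U [e [oU _ /(_ p oU.2) be]]] := pD p.
pose F (i : 'I_3) := nth 0 [:: e 0 p; e 1 p; J p (X p)] i.
have De i : D p (e i p) := basis_mem i be.
have dE : has_dim 3 (E p) by have [[]] := D_engel.
have TJ := tangentJ J_ac (assoc_tangent p).
have comb (a : 'I_3 -> R) : exists u, [/\ D p u,
    \sum_i a i *: F i = u + a ord_max *: J p (X p) &
    u = \sum_i a (widen_ord (leqnSn 2) i) *: e i p].
  exists (\sum_i a (widen_ord (leqnSn 2) i) *: e i p); split=> //.
    by apply: subspace_sum => // i; apply: subspaceZ.
  rewrite big_ord_recr /=; congr (_ + _).
  apply: eq_bigr => -[[|[|]] ?] _ //=; congr (_ *: e _ p); exact: val_inj.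
(* Since beta vanishes on D and is -1 on JX, it reads off the coefficient of JX up to sign. This
   serves twice: for the independence of [F], and to put [v] in D when beta(v) = 0. *)
have combb (a : 'I_3 -> R) u : D p u ->
    beta p (u + a ord_max *: J p (X p)) = - a ord_max.
  move=> Du; have Tu := engel_tangent Du.
  rewrite addrC fb.1 // (engel_formJ Du) addr0 assoc_formJJ mulrN1 //.
have FI : lin_indep F.
  move=> a; have [u [Du -> ue]] := comb a => e0.
  have a2 : a ord_max = 0.
    by apply: oppr_inj; rewrite -(combb a u Du) e0 one_form0 // oppr0.
  move: e0; rewrite a2 scale0r addr0 ue => /(be.1 (fun i => a _)) a01 i.
  have [i2|i2] := ltnP i 2.
    by rewrite -(a01 (Ordinal i2)); congr a; exact: val_inj.
  rewrite -a2; congr a; apply: val_inj => /=.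
  by apply/eqP; rewrite eqn_leq i2 -ltnS ltn_ord.
have FE i : E p (F i).
  case: i => -[|[|[|]]] //= ?; rewrite /F /=; try by apply: engel_sub; exact: De.
  exact: (assoc_J_bracket p).
have /(basisP _ (lin_indep_basis dE FI FE))[a va] : E p v.
  by apply/bracket_distE.
have [u [Du vu _]] := comb a; move: va; rewrite vu => va.
have : - a ord_max = 0 by rewrite -(combb a u Du) -va.
by move=> /eqP; rewrite oppr_eq0 => /eqP a2; rewrite va a2 scale0r addr0.
Qed.

Lemma char_foliation_sub W p : characteristic_foliation D W -> W p `<=` D p.
Proof.
move=> [pW WE cW]; have sE := subspace_bracket_dist.
have [U0 [w [oU0 W0 /(_ p oU0.2) bw]]] := pW p.
have wE : is_section E U0 (w 0).
  by split=> [|q Uq]; [exact: (W0 0).1|apply/WE/(W0 0).2].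
suff bw0 : beta p (w 0 p) = 0.
  move=> v /(basisP _ bw)[a ->]; rewrite big_ord1; apply: subspaceZ => //.
  have [Tw aw] := (bracket_distE _ _).1 (wE.2 p oU0.2).
  exact/engel_kernel.
(* Otherwise every section V of E near p satisfies
   beta(w) V = beta(V) w + a section of D, so that [D, E] is contained in E. *)
apply/eqP/negPn/negP => bw0.
(* The Engel condition [D, E] = TM would then put X in E = ker alpha, against alpha(X) = 1. *)
suff DE : bracket_dist D E p `<=` E p.
  have [[_ _ /(_ p) DET] _] := D_engel.
  have : E p (X p) by apply: DE; rewrite DET; exact: assoc_tangent.
  by move=> /bracket_distE[_ /eqP]; rewrite assoc_form oner_eq0.
apply: lin_span_sub => // _ [U1 [Y [V [oU1 DY EV ->]]]].
pose U := U1 `&` U0; have oU : open_nbhs p U by apply: open_nbhsI.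
have {}DY : is_section D U Y by apply: is_section_sub DY => q [].
have {}EV : is_section E U V by apply: is_section_sub EV => q [].
have {}wE : is_section E U (w 0) by apply: is_section_sub wE => q [].
have {}W0 : is_section W U (w 0) by apply: is_section_sub (W0 0) => q [].
have YE : is_section E U Y by split=> [|q Uq]; [exact: DY.1|apply/engel_sub/DY.2].
pose g q := beta q (w 0 q); pose h q := - beta q (V q).
have sg q : U q -> smooth_at g q by move=> Uq; apply: (fb.2 U _ oU.1 wE.1).
have sh q : U q -> smooth_at h q.
  by move=> Uq; apply: smooth_atN; apply: (fb.2 U _ oU.1 EV.1).
have s0 := @smooth_vfield0 _ _ M U.
have shw : smooth_vfield U (fun q => h q *: w 0 q + 0) by apply: smooth_vfieldZD wE.1 s0.
have DT : is_section D U (fun q => g q *: V q + (h q *: w 0 q + 0)).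
  split=> [|q Uq]; first exact: smooth_vfieldZD EV.1 shw.
  have /bracket_distE[TV aV] := EV.2 q Uq; have /bracket_distE[Tw aw] := wE.2 q Uq.
  have Thw : tangent q (h q *: w 0 q) by apply: subspaceZ => //; exact: subspace_tangent.
  apply/engel_kernel; rewrite addr0; split.
  - exact: (subspace_tangent q).2.
  - by rewrite fa.1 // one_formZ // aV aw !mulr0 addr0.
  - by rewrite fb.1 // one_formZ // /h /g mulNr mulrC subrr.
(* The bracket of [Y] with the section beta(w) V - beta(V) w of D lies in E. In its expansion the
   derivative terms are multiples of [V] and [w 0], and [Y, w] lies in E because W is
   characteristic. Hence beta(w) [Y, V] lies in E, and beta(w) is invertible at [p]. *)
have := bracket_distP oU DY DT.
rewrite (lie_bracketZD oU.2 (sg p oU.2) DY.1 EV.1 shw).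
rewrite (lie_bracketZD oU.2 (sh p oU.2) DY.1 wE.1 s0).
rewrite (lie_bracket0 oU DY.1) addr0 => EgV.
have EYw : E p (lie_bracket Y (w 0) p).
  rewrite lie_bracketC -scaleN1r; apply: subspaceZ => //.
  by apply: cW; exact: bracket_distP oU W0 YE.
rewrite -[lie_bracket _ _ _](scalerK bw0); apply: subspaceZ => //.
rewrite -[_ *: lie_bracket Y V p](addrK (Y p g *: V p)).
have EV' := EV.2 p oU.2; have Ew' := wE.2 p oU.2.
apply: subspaceB => //; last exact: subspaceZ.
rewrite -[_ + _](addrK (h p *: lie_bracket Y (w 0) p + Y p h *: w 0 p)).
by apply: subspaceB => //; apply: subspaceD => //; apply: subspaceZ.
Qed.

(** A generator [w] of W at [p] lies in D, so w and Jw form a basis of the plane D. The pair (alpha,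
    -beta) is dual to (X, JX) and vanishes on D, which separates the other two lines from D. *)
Lemma splitting_direct_sum W p : characteristic_foliation D W ->
  is_direct_sum (splitting J W (line_of X) p) (tangent p).
Proof.
move=> cW; have WD := char_foliation_sub (p := p) cW; have [pW _ _] := cW.
have [U [w' [oU W0 /(_ p oU.2) bw]]] := pW p.
set w := w' 0 p; have Dw : D p w by apply/WD/(W0 0).2/oU.2.
have w0 : w <> 0.
  move=> w0; suff /(bw.1 (fun=> 1))/(_ 0)/eqP : \sum_(i < 1) 1 *: w' i p = 0.
    by rewrite oner_eq0.
  by rewrite big_ord1 -/w w0 scaler0.
have We : W p = lin_span [set w] by case: bw => _ ->; rewrite lin_span_range1.
have Tw := engel_tangent Dw; have TJw := tangentJ J_ac Tw.
have DJw : D p (J p w) by have [_ <-] := D_engel; exists w.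
have TX := assoc_tangent p; have TJX := tangentJ J_ac TX.
have sT := subspace_tangent p.
pose F (i : 'I_4) := nth 0 [:: w; J p w; J p (X p); X p] i.
have sumF (a : 'I_4 -> R) : \sum_i a i *: F i =
    (a 0 *: w + a 1 *: J p w) + (a 2%:R *: J p (X p) + a 3%:R *: X p).
  rewrite !big_ord_recl big_ord0 addr0 !addrA /F /=.
  by congr (a _ *: _ + a _ *: _ + a _ *: _ + a _ *: _); apply: val_inj.
apply: (@basis_direct_sum _ _ _ F); last first.
  case=> -[|[|[|[|]]]] //= i4; rewrite /splitting /F /J_image /= ?We //.
  - by rewrite J_image_line.
  - by rewrite /line_of J_image_line.
have combab (u : (M -> R) -> R) (c d : R) : D p u ->
    alpha p (u + (c *: J p (X p) + d *: X p)) = d /\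
    beta p (u + (c *: J p (X p) + d *: X p)) = - c.
  move=> Du; have Tu := engel_tangent Du.
  have Tc : tangent p (c *: J p (X p)) by exact: subspaceZ.
  have Td : tangent p (d *: X p) by exact: subspaceZ.
  have Tcd := subspaceD sT Tc Td; split.
    rewrite !one_formD // !one_formZ // engel_form // assoc_form.
    have -> : alpha p (J p (X p)) = 0 by exact: assoc_formJ.
    by rewrite mulr0 mulr1 !add0r.
  rewrite !(one_formD fb) // !(one_formZ _ fb) // engel_formJ // assoc_formJ.
  by rewrite assoc_formJJ mulr0 addr0 add0r mulrN1.
have Dcomb (a b : R) : D p (a *: w + b *: J p w).
  by apply: (sD p).2 => //; exact: subspaceZ.
have TF i : tangent p (F i) by case: i => -[|[|[|[|]]]].
have FI : lin_indep F.
  move=> a; rewrite sumF => e0.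
  have [+ +] := combab _ (a 2%:R) (a 3%:R) (Dcomb (a 0) (a 1)).
  rewrite e0 !one_form0 // => a3 /esym/eqP; rewrite oppr_eq0 => /eqP a2.
  move: e0; rewrite -a3 a2 !scale0r !addr0 => /(almost_complex_indep J_ac Tw w0)[a0 a1] i.
  case: i => -[|[|[|[|]]]] //= i4.
  - by rewrite -[RHS]a0; congr a; apply: val_inj.
  - by rewrite -[RHS]a1; congr a; apply: val_inj.
  - by rewrite -[RHS]a2; congr a; apply: val_inj.
  - by rewrite [RHS]a3; congr a; apply: val_inj.
split=> //; apply/seteqP; split=> [v Tv|]; last first.
  by apply: lin_span_sub => // _ [i _ <-].
(* The projection of [v] to D along JX and X: the correction cancels alpha(v) and beta(v), with a
   plus sign on JX because beta(JX) = -1. *)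
pose u := v + (beta p v *: J p (X p) - alpha p v *: X p).
have Tu1 : tangent p (beta p v *: J p (X p)) by exact: subspaceZ.
have Tu2 : tangent p (alpha p v *: X p) by exact: subspaceZ.
have Du : D p u.
  apply/engel_kernel; split; first by apply: subspaceD => //; exact: subspaceB.
    rewrite one_formD // ?one_formB // ?one_formZ //; last exact: subspaceB.
    have -> : alpha p (J p (X p)) = 0 by exact: assoc_formJ.
    by rewrite assoc_form mulr0 mulr1 sub0r subrr.
  rewrite (one_formD fb) // ?(one_formB fb) // ?(one_formZ _ fb) //; last exact: subspaceB.
  by rewrite assoc_formJ assoc_formJJ mulr0 mulrN1 subr0 subrr.
pose G (i : 'I_2) := nth 0 [:: w; J p w] i.
have sumG (a : 'I_2 -> R) : \sum_i a i *: G i = a 0 *: w + a 1 *: J p w.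
  rewrite big_ord_recl big_ord1 /G /=.
  by congr (a _ *: _ + a _ *: _); apply: val_inj.
have GI : lin_indep G.
  move=> a; rewrite sumG => /(almost_complex_indep J_ac Tw w0)[a0 a1].
  case=> -[|[|]] //= i2; [rewrite -[RHS]a0|rewrite -[RHS]a1]; congr a; exact: val_inj.
have dD : has_dim 2 (D p) by have [U' [e [oU' _ /(_ p oU'.2) be]]] := pD p; exists (e^~ p).
have GD i : D p (G i) by case: i => -[|[|]].
have /(basisP _ (lin_indep_basis dD GI GD))[a] := Du; rewrite sumG => ua.
apply/lin_spanP; exists (fun i => nth 0 [:: a 0; a 1; - beta p v; alpha p v] i).
by rewrite sumF /= -ua /u scaleNr (addrC (- _)) -(opprB (beta p v *: _)) addrK.
Qed.

(** In the value of beta /\ d beta on (X, Y, JX), the terms with factor beta(X) or beta(Y) vanish,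
    and beta(JX) = -1 leaves -d beta(X, Y). As beta(X) and beta(Y) vanish near [p], this is
    beta([X, Y]). *)
Lemma assoc_bracket U p Y : open_nbhs p U -> is_section D U Y ->
  beta p (lie_bracket X Y p) = 0.
Proof.
move=> oU DY; have [sX iX _ _] := X_assoc; have [_ _ _ sJ] := J_ac.
have UX : smooth_vfield U X by apply: smooth_vfield_sub sX.
have := iX U Y (fun q => J q (X q)) oU.1 DY.1 (sJ U X oU.1 UX) p oU.2.
have eY q : U q -> eval_form beta Y q = 0 by move=> Uq; apply/engel_formJ/DY.2.
rewrite /interior_prod /wedge12 eY ?[eval_form beta X p]assoc_formJ; last exact: oU.2.
rewrite [eval_form beta _ p]assoc_formJJ !mul0r subr0 add0r mulN1r => /eqP.
rewrite oppr_eq0 /ext_deriv (tangent_near0 (assoc_tangent p)); last by exists U.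
rewrite (tangent_near0 (DY.1 p oU.2).1).
  by rewrite subrr sub0r oppr_eq0 => /eqP.
by exists U => // q _; exact: assoc_formJ.
Qed.

(** The derivative term Y(g) Z lies in D and is killed by beta. On sections of D, beta([Y, .]) is
    therefore linear over smooth functions. *)
Lemma formJ_bracketZD U p (g : M -> R) Y Z T : open_nbhs p U -> smooth_at g p ->
  smooth_vfield U Y -> is_section D U Z -> smooth_vfield U T ->
  beta p (lie_bracket Y (fun q => g q *: Z q + T q) p) =
  g p * beta p (lie_bracket Y Z p) + beta p (lie_bracket Y T p).
Proof.
move=> oU sg UY DZ UT; rewrite (lie_bracketZD oU.2 sg UY DZ.1 UT).
have sT := subspace_tangent p; have DZp := DZ.2 p oU.2.
have TYZ := tangent_lie_bracket oU UY DZ.1.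
have TYT := tangent_lie_bracket oU UY UT.
have TZ := engel_tangent DZp.
rewrite !(one_formD fb) ?(one_formZ _ fb) //; try exact: subspaceZ.
  by rewrite (engel_formJ DZp) mulr0 addr0.
by apply: subspaceD => //; exact: subspaceZ.
Qed.

Lemma formJ_bracketC U p Y Z : open_nbhs p U -> smooth_vfield U Y ->
  smooth_vfield U Z ->
  beta p (lie_bracket Y Z p) = - beta p (lie_bracket Z Y p).
Proof.
move=> oU UY UZ; rewrite lie_bracketC one_formN //.
exact: tangent_lie_bracket oU UZ UY.
Qed.

(* The restriction of d(beta) to D is nondegenerate, as otherwise [D, D] would be
   contained in ker(beta), but JX is a section of [D, D] and beta(JX) = -1. *)
Lemma engel_bracket_nondegenerate U p d : open_nbhs p U -> is_section D U d ->
  (forall U' Y, open_nbhs p U' -> is_section D U' Y ->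
     beta p (lie_bracket d Y p) = 0) -> d p = 0.
Proof.
move=> oU Dd d0; have [ O [e1 [e2 [g [oO De1 De2 g0 [sg cramer]]]]]] := plane_field_cramer p pD.
have coords U' Y : open_nbhs p U' -> U' `<=` O -> is_section D U' Y ->
    exists P Q : R, g p *: Y p = P *: e1 p + Q *: e2 p /\
    forall Z, smooth_vfield U' Z -> g p * beta p (lie_bracket Z Y p) =
      P * beta p (lie_bracket Z e1 p) + Q * beta p (lie_bracket Z e2 p).
  move=> oU' sU' DY; have [P [Q [sP sQ PQ]]] := cramer U' Y sU' DY.
  exists (P p), (Q p); split=> [|Z UZ]; first exact/PQ/oU'.2.
  have D1 := is_section_sub sU' De1; have D2 := is_section_sub sU' De2.
  have s0 := @smooth_vfield0 _ _ M U'.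
  have nP q : U' q -> smooth_at (fun q => - P q) q by move=> /sP; exact: smooth_atN.
  have nQ q : U' q -> smooth_at (fun q => - Q q) q by move=> /sQ; exact: smooth_atN.
  have s2 := smooth_vfieldZD nQ D2.1 s0; have s1 := smooth_vfieldZD nP D1.1 s2.
  have gp : smooth_at g p by apply: sg; exact: oO.2.
  (* The field g Y - P e1 - Q e2 vanishes on [U'], hence so does its bracket with [Z] at [p]; beta
     of that bracket is expanded term by term. *)
  have := formJ_bracketZD oU' gp UZ DY s1.
  rewrite (lie_bracket_near0 oU' UZ); last first.
    by move=> q Uq; rewrite PQ // addr0 !scaleNr -opprD subrr.
  rewrite (formJ_bracketZD oU' (nP p oU'.2) UZ D1 s2).
  rewrite (formJ_bracketZD oU' (nQ p oU'.2) UZ D2 s0).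
  rewrite (lie_bracket0 oU' UZ) (one_form0 _ fb) addr0 !mulNr -opprD => /esym/eqP.
  by rewrite subr_eq0 => /eqP.
(* By antisymmetry, [k] determines beta([., .]) on the whole frame [e1], [e2]. *)
set k := beta p (lie_bracket e1 e2 p).
have alt Z : smooth_vfield O Z -> beta p (lie_bracket Z Z p) = 0.
  move=> OZ; have /eqP := formJ_bracketC oO OZ OZ.
  by rewrite -subr_eq0 opprK -mulr2n mulrn_eq0 => /eqP.
have k' : beta p (lie_bracket e2 e1 p) = - k by exact: formJ_bracketC oO De2.1 De1.1.
have k0 : k != 0.
  apply/eqP => k0; have : beta p (J p (X p)) = 0; last first.
    by move/eqP; rewrite assoc_formJJ oppr_eq0 oner_eq0.
  suff : E p `<=` [set v | tangent p v /\ beta p v = 0].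
    by move=> /(_ _ (assoc_J_bracket p))[].
  apply: lin_span_sub => [|_ [U' [Y [Z [oU' DY DZ ->]]]]]; first exact: subspace_kernel.
  split; first exact: tangent_lie_bracket oU' DY.1 DZ.1.
  pose O' := U' `&` O; have oO' : open_nbhs p O' by exact: open_nbhsI.
  have sO' : O' `<=` O by move=> q [].
  have {}DY : is_section D O' Y by apply: is_section_sub DY => q [].
  have {}DZ : is_section D O' Z by apply: is_section_sub DZ => q [].
  have D1 := is_section_sub sO' De1; have D2 := is_section_sub sO' De2.
  (* [Z] is expanded in the frame first, then [Y] after exchanging the arguments; every resulting
     entry is 0 when [k] is. *)
  have [P [Q [_ PQ]]] := coords O' Y oO' sO' DY.
  have [P' [Q' [_ PQ']]] := coords O' Z oO' sO' DZ.
  apply: (mulfI g0); rewrite PQ' ?mulr0; last exact: DY.1.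
  rewrite (formJ_bracketC oO' DY.1 D1.1) (formJ_bracketC oO' DY.1 D2.1).
  have -> : beta p (lie_bracket e1 Y p) = 0.
    apply: (mulfI g0); rewrite PQ; last exact: D1.1.
    by rewrite alt ?mulr0 ?add0r -/k ?k0 ?mulr0 //; exact: De1.1.
  have -> : beta p (lie_bracket e2 Y p) = 0.
    apply: (mulfI g0); rewrite PQ; last exact: D2.1.
    by rewrite k' k0 alt ?oppr0 ?mulr0 ?addr0 //; exact: De2.1.
  by rewrite oppr0 !mulr0 addr0.
pose O' := U `&` O; have oO' : open_nbhs p O' by exact: open_nbhsI.
have sO' : O' `<=` O by move=> q [].
have {}Dd : is_section D O' d by apply: is_section_sub Dd => q [].
have D1 := is_section_sub sO' De1; have D2 := is_section_sub sO' De2.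
have [P [Q [gd PQ]]] := coords O' d oO' sO' Dd.
(* Bracketing [d] with [e1] isolates Q k, and bracketing it with [e2] isolates -P k. *)
have Q0 : Q = 0.
  apply: (mulIf k0); rewrite mul0r.
  have := PQ _ D1.1; rewrite (formJ_bracketC oO' D1.1 Dd.1) (d0 O') //.
  by rewrite oppr0 mulr0 alt ?mulr0 ?add0r //; exact: De1.1.
have P0 : P = 0.
  apply: (mulIf k0); rewrite mul0r.
  have := PQ _ D2.1; rewrite (formJ_bracketC oO' D2.1 Dd.1) (d0 O') //.
  rewrite oppr0 mulr0 k' alt ?mulr0 ?addr0; last exact: De2.1.
  by rewrite mulrN => /esym/eqP; rewrite oppr_eq0 => /eqP.
by rewrite -[d p](scalerK g0) gd P0 Q0 !scale0r addr0 scaler0.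
Qed.

End AssociatedField.
End DefiningForm.

Lemma assoc_collinear alpha alpha' X X' p :
  defining_form E alpha -> associated_vfield J alpha X ->
  defining_form E alpha' -> associated_vfield J alpha' X' ->
  X' p = alpha p (X' p) *: X p.
Proof.
move=> alphaE X_assoc alphaE' X_assoc'.
have fa : one_form alpha by case: alphaE.
have fb : one_form (form_comp alpha J) by exact: one_form_comp.
have TX q := assoc_tangent X_assoc q.
have TX' q := assoc_tangent X_assoc' q.
have [sX _ _ _] := X_assoc; have [sX' _ _ _] := X_assoc'.
have fa' : one_form alpha' by case: alphaE'.
have fb' : one_form (form_comp alpha' J) by exact: one_form_comp.
(* The vector v - alpha'(v) X' is in the kernel of alpha', which is E, and thus in the kernel of
   alpha. *)
have alphaZ q v : tangent q v -> alpha q v = alpha q (X' q) * alpha' q v.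
  move=> Tv; have sT := subspace_tangent q.
  have Tv' : tangent q (alpha' q v *: X' q) by exact: subspaceZ.
  suff /(bracket_distE alphaE)[_] : E q (v - alpha' q v *: X' q).
    by rewrite one_formB // one_formZ // mulrC => /eqP; rewrite subr_eq0 => /eqP.
  rewrite (bracket_distE alphaE'); split; first exact: subspaceB.
  by rewrite one_formB // one_formZ // (assoc_form X_assoc') mulr1 subrr.
have bZ q v : tangent q v -> form_comp alpha J q v = alpha q (X' q) * form_comp alpha' J q v.
  by move=> Tv; apply: alphaZ; exact: tangentJ.
(* The coefficient is chosen so that alpha(d) = 0; beta(d) = 0 holds because beta kills X and, being
   proportional to beta', also X'. *)
pose c q := - alpha q (X' q); pose d q := c q *: X q + X' q.
have oT : open [set: M] by exact: openT.
have sc q : smooth_at c q by apply: smooth_atN; exact: (fa.2 setT X' oT sX' q I).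
have sd : smooth_vfield setT d by apply: smooth_vfieldZD.
have Dd : is_section D setT d.
  split=> // q _; apply/(engel_kernel alphaE X_assoc); split; first exact: (sd q I).1.
    by rewrite fa.1 // (assoc_form X_assoc) mulr1 addNr.
  rewrite fb.1 // (assoc_formJ X_assoc) mulr0 add0r bZ //.
  by rewrite (assoc_formJ X_assoc') mulr0.
suff : d p = 0 by rewrite /d /c scaleNr addrC => /eqP; rewrite subr_eq0 => /eqP.
apply: (engel_bracket_nondegenerate alphaE X_assoc (U := setT)) => // U Y oU DY.
have UX : smooth_vfield U X by exact: smooth_vfield_sub sX.
have UX' : smooth_vfield U X' by exact: smooth_vfield_sub sX'.
have Ud : smooth_vfield U d by exact: smooth_vfield_sub sd.
have Tb := tangent_lie_bracket oU DY.1.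
have YX : form_comp alpha J p (lie_bracket Y X p) = 0.
  by rewrite (formJ_bracketC alphaE oU DY.1 UX) (assoc_bracket alphaE X_assoc oU DY) oppr0.
have YX' : form_comp alpha J p (lie_bracket Y X' p) = 0.
  rewrite (formJ_bracketC alphaE oU DY.1 UX') bZ; last exact: tangent_lie_bracket oU UX' DY.1.
  by rewrite (assoc_bracket alphaE' X_assoc' oU DY) mulr0 oppr0.
rewrite (formJ_bracketC alphaE oU Ud DY.1) /d (lie_bracketZD oU.2 (sc p) DY.1 UX UX').
have sT := subspace_tangent p; have TYX := Tb _ UX; have TYX' := Tb _ UX'.
(* X is not a section of D, but the derivative term Y(c) X is killed all the same, as beta(X) =
   0. *)
rewrite !(one_formD fb) ?(one_formZ _ fb) //; try exact: subspaceZ.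
  by rewrite YX YX' (assoc_formJ X_assoc) !mulr0 !addr0 oppr0.
by apply: subspaceD; rewrite ?subspaceZ //; apply: subspaceZ.
Qed.

End JEngel.

Theorem proposition4p1 (R : realType) (M : smoothManifold R 4)
    (J : M -> ((M -> R) -> R) -> ((M -> R) -> R))
    (D W : M -> set ((M -> R) -> R))
    (M_closed : closed_manifold M)
    (J_ac : almost_complex J)
    (D_engel : J_engel J D)
    (W_char : characteristic_foliation D W) :
  (forall (alpha : M -> ((M -> R) -> R) -> R) (X : M -> ((M -> R) -> R)),
     defining_form (bracket_dist D D) alpha -> associated_vfield J alpha X ->
     forall p : M, is_direct_sum (splitting J W (line_of X) p) (tangent p)) /\
  (forall (alpha1 alpha2 : M -> ((M -> R) -> R) -> R)
          (X1 X2 : M -> ((M -> R) -> R)),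
     defining_form (bracket_dist D D) alpha1 ->
     defining_form (bracket_dist D D) alpha2 ->
     associated_vfield J alpha1 X1 -> associated_vfield J alpha2 X2 ->
     forall p : M, splitting J W (line_of X1) p = splitting J W (line_of X2) p).
Proof.
split=> [alpha X alphaE X_assoc p|alpha1 alpha2 X1 X2 E1 E2 A1 A2 p].
  exact: (splitting_direct_sum J_ac D_engel alphaE X_assoc p W_char).
(* The splitting depends on the associated field only through the line it spans, so a nonzero factor
   between the two fields suffices. *)
congr splitting; apply/funext => q; rewrite /line_of.
rewrite (assoc_collinear J_ac D_engel q E1 A1 E2 A2) lin_span_set1Z //.
(* A zero factor would give X2 = 0 at [q], against alpha2(X2) = 1. *)
apply/eqP => c0; have := assoc_form A2 q.
rewrite (assoc_collinear J_ac D_engel q E1 A1 E2 A2) c0 scale0r.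
by rewrite (one_form0 _ E2.1) => /esym/eqP; rewrite oner_eq0.
Qed.
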